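(* Let $1 \leq k \leq n-1$ be integers and let $\delta_0$ be the largest real eigenvalue of the linear operator $\hat c_1$ associated with the Grassmannian $\mathrm{Gr}(k,n)$ (defined in the context). Then $\delta_0 \geq \dim \mathrm{Gr}(k,n) + 1 = k(n-k)+1$, with equality if and only if $\mathrm{Gr}(k,n)$ is the projective space $\mathbb{P}^{n-1}$ (i.e. $k=1$ or $k=n-1$).
   Context: $\mathrm{Gr}(k,n)$ is the Grassmannian of $k$-dimensional linear subspaces of $\mathbb{C}^n$. Let $\Lambda$ be the set of partitions $\lambda=(\lambda_1\geq \cdots\geq \lambda_k)$ with $n-k\geq \lambda_1$ and $\lambda_k\geq 0$, and $|\lambda|=\lambda_1+\cdots+\lambda_k$. For $\lambda\in\Lambda$ with $\lambda_1=n-k$ and $\lambda_k>0$ put $\lambda^*=(\lambda_2-1\geq\cdots\geq\lambda_k-1\geq 0)$; otherwise $\lambda^*$ does not exist. The operator $\hat c_1$ (quantum multiplication by the anticanonical class $c_1(\mathrm{Gr}(k,n))=n\sigma_{(1)}$ in small quantum cohomology, specialized at $q=1$) is the linear endomorphism of the real (or complex) vector space with basis $\{\sigma_\lambda\}_{\lambda\in\Lambda}$ given by $\hat c_1(\sigma_\lambda)=n\sigma_{\lambda^*}+n\sum\sigma_\mu$, the sum over all $\mu\in\Lambda$ with $|\mu|=|\lambda|+1$ and $\lambda\subset\mu$, and the term $n\sigma_{\lambda^*}$ omitted if $\lambda^*$ does not exist. $\delta_0$ denotes the largest real eigenvalue of $\hat c_1$ (which equals the maximum modulus of its eigenvalues).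 *)

(* Defs.v *)
From HB Require Import structures.
From mathcomp Require Import all_boot all_order all_algebra.
From mathcomp Require Import reals.
Set Implicit Arguments. Unset Strict Implicit. Unset Printing Implicit Defensive.
Import Order.TTheory GRing.Theory Num.Theory.
Local Open Scope ring_scope.

(* Partitions lambda = (lambda_1 >= ... >= lambda_k) with n-k >= lambda_1 and
   lambda_k >= 0, encoded as finite functions 'I_k -> 'I_(n-k+1)
   (index i : 'I_k stands for lambda_{i+1}). *)
Definition nonincr (k n : nat) (f : {ffun 'I_k -> 'I_(n - k).+1}) : bool :=
  [forall i : 'I_k, forall j : 'I_k, (i <= j)%N ==> (val (f j) <= val (f i))%N].

Definition Lambda (k n : nat) := {f : {ffun 'I_k -> 'I_(n - k).+1} | nonincr f}.
HB.instance Definition _ (k n : nat) := Finite.on (Lambda k n).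

Definition parts (k n : nat) (l : Lambda k n) : seq nat :=
  [seq val (val l i) | i <- enum 'I_k].

Definition psize (k n : nat) (l : Lambda k n) : nat := sumn (parts l).

(* lambda^* exists and equals mu:  lambda_1 = n-k, lambda_k > 0, and
   mu = (lambda_2 - 1 >= ... >= lambda_k - 1 >= 0). *)
Definition is_star (k n : nat) (l mu : Lambda k n) : bool :=
  [&& (0 < k)%N, nth 0 (parts l) 0 == (n - k)%N, (0 < nth 0 (parts l) k.-1)%N &
      [forall i : 'I_k, nth 0 (parts mu) i ==
         (if (i.+1 < k)%N then (nth 0 (parts l) i.+1).-1 else 0%N)]].

Definition pcontained (k n : nat) (l mu : Lambda k n) : bool :=
  [forall i : 'I_k, val (val l i) <= val (val mu i)]%N.

Definition is_succ (k n : nat) (l mu : Lambda k n) : bool :=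
  (psize mu == (psize l).+1) && pcontained l mu.

(* Matrix of c1hat in the basis {sigma_lambda}, basis enumerated via enum_val;
   row i is the image of sigma_(enum_val i) (row-vector convention). *)
Definition c1hat (R : fieldType) (k n : nat) : 'M[R]_#|{: Lambda k n}| :=
  \matrix_(i, j) (n%:R * ((is_star (enum_val i) (enum_val j))%:R
                           + (is_succ (enum_val i) (enum_val j))%:R)).

Definition largest_real_eigenvalue (R : realType) (N : nat) (A : 'M[R]_N) (d : R) : Prop :=
  eigenvalue A d /\ (forall e : R, eigenvalue A e -> e <= d).

(* Main.v *)
Require Import Defs.
From HB Require Import structures.
From mathcomp Require Import all_boot all_order all_algebra.
From mathcomp Require Import reals.
From mathcomp Require Import complex topology normedtype derive trigo.
From mathcomp Require Import ring lra zify.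
Import Order.TTheory GRing.Theory Num.Theory.
Import numFieldNormedType.Exports.
Local Open Scope ring_scope.

(* Encode lambda by the strictly decreasing positions p_i = lambda_i + k - i
   (i = 1..k) in {0, ..., n-1}.  Then c1hat / n moves one of k particles on the
   cycle Z/n one step forward (lambda^* being the jump from n-1 to 0), a free
   fermion system.  Its ground state prod_{i<j} sin(pi (p_i - p_j) / n) is
   positive, and Lagrange interpolation at the points e^(2 pi i p_j / n) shows
   that it is an eigenvector for sin(pi k / n) / sin(pi / n).  A positive
   eigenvector of a nonnegative matrix belongs to the largest real eigenvalue,
   so delta_0 = n sin(pi k / n) / sin(pi / n).

   By k <-> n - k assume 2 k <= n.  From cos y >= 1 - y^2/2 and
   sin((k+2)x) = sin(kx) + 2 sin x cos((k+1)x) one gets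
   sin(kx) / sin x >= k - x^2 k (k^2-1) / 6, so that
   delta_0 - (k(n-k) + 1) >= (k^2-1) (1 - pi^2 k / (6n)),
   where the last factor is positive because pi^2 < 12. *)

(** * Lagrange interpolation at k points *)

(** Let P be the monic polynomial with roots x_c. Then Q(y) = P(t y) - t^k P(y) has degree less than
    k and Q(x_b) = P(t x_b). Evaluating its Lagrange expansion at 0 gives (1 - t^k) P(0) on one
    side; on the other, the factor (t - 1) x_b of P(t x_b) completes the b-th term to a multiple of
    P(0). *)
Lemma sum_interpolation (F : fieldType) (k : nat) (t : F) (x : 'I_k -> F) :
  injective x -> (forall i, x i != 0) ->
  (t - 1) * (\sum_b \prod_(c | c != b) ((t * x b - x c) / (x b - x c)))
  = t ^+ k - 1.
Proof.
move=> x_inj x_neq0.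
pose P : {poly F} := \prod_c ('X - (x c)%:P).
have sizeP : size P = k.+1.
  by rewrite size_prod_XsubC /index_enum -enumT size_enum_ord.
have P_x y : P.[y] = \prod_c (y - x c).
  by rewrite horner_prod; apply: eq_bigr => c _; rewrite !hornerE.
(* The sum stops below k because the coefficient at k would be t^k - t^k. *)
pose Q : {poly F} := \poly_(i < k) (P`_i * (t ^+ i - t ^+ k)).
have Q_x y : Q.[y] = P.[t * y] - t ^+ k * P.[y].
  rewrite horner_poly !horner_coef sizeP mulr_sumr -sumrB big_ord_recr /=.
  rewrite exprMn [_ * (_ * _)]mulrCA subrr addr0.
  by apply: eq_bigr => i _; rewrite exprMn; ring.
pose ell b : {poly F} := \prod_(c | c != b) ((x b - x c)^-1 *: ('X - (x c)%:P)).
have ell_x b y : (ell b).[y] = \prod_(c | c != b) ((y - x c) / (x b - x c)).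
  by rewrite horner_prod; apply: eq_bigr => c _; rewrite !hornerE mulrC.
have sub_x_neq0 b c : c != b -> x b - x c != 0.
  by move=> ne; rewrite subr_eq0 inj_eq // eq_sym.
have size_ell b : (size (ell b) <= k)%N.
  apply: leq_trans (size_poly_prod_leq _ _) _.
  have : (\sum_(c | c != b) size ((x b - x c)^-1 *: ('X - (x c)%:P))
          <= \sum_(c : 'I_k | c != b) 2)%N.
    apply: leq_sum => c _; apply: leq_trans (size_scale_leq _ _) _.
    by rewrite size_XsubC.
  have b_lt := ltn_ord b; rewrite sum_nat_const cardC1 card_ord => le2.
  apply: leq_trans (leq_sub2r k.-1 (le2 : (_ < _.+1)%N)) _; lia.
(* Both sides have size at most k and agree at the k distinct points x_c. *)
have QE : Q = \sum_b Q.[x b] *: ell b.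
  apply/eqP; rewrite -subr_eq0; apply/eqP.
  apply: (@roots_geq_poly_eq0 _ _ [seq x c | c <- enum 'I_k]).
  - apply/allP => _ /mapP[c _ ->]; rewrite /root hornerE hornerN horner_sum.
    rewrite (bigD1 c) //= !hornerE ell_x big1 => [|d ne]; last first.
      by rewrite divff // sub_x_neq0.
    rewrite mulr1 big1 => [|d ne]; first by rewrite addr0 subrr.
    rewrite hornerE ell_x (bigD1 c) 1?eq_sym //= subrr.
    by rewrite !mul0r mulr0.
  - by rewrite map_inj_uniq ?enum_uniq.
  rewrite size_map size_enum_ord; apply: leq_trans (size_polyD _ _) _.
  rewrite geq_max size_poly size_polyN; apply: leq_trans (size_sum _ _ _) _.
  by apply/bigmax_leqP => b _; apply: leq_trans (size_scale_leq _ _) _.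
have P0_neq0 : P.[0] != 0.
  by rewrite P_x; apply/prodf_neq0 => c _; rewrite sub0r oppr_eq0.
have term b : (Q.[x b] *: ell b).[0] = - P.[0] *
    ((t - 1) * \prod_(c | c != b) ((t * x b - x c) / (x b - x c))).
  rewrite hornerE ell_x Q_x !P_x (bigD1 b) //= [X in _ - _ * X](bigD1 b) //=.
  rewrite [\prod_c (0 - _)](bigD1 b) //= subrr mul0r mulr0 subr0 !prodf_div.
  by ring.
apply: (mulfI P0_neq0).
have := congr1 (fun p => p.[0]) QE.
rewrite horner_sum (eq_bigr _ (fun b _ => term b)) -!mulr_sumr Q_x mulr0.
by rewrite mulNr => e; rewrite -[LHS]opprK -e; ring.
Qed.

(** * From exponentials to sines *)

Section SineIdentity.
Variable R : realType.
Implicit Types x y h : R.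
Local Open Scope complex_scope.

Definition expi x : R[i] := cos x +i* sin x.

Lemma expiD x y : expi (x + y) = expi x * expi y.
Proof. by apply/eqP; rewrite eq_complex /= cosD sinD eqxx /= addrC. Qed.

Lemma expi_neq0 x : expi x != 0.
Proof.
apply: contraTneq (oner_neq0 R) => /eqP; rewrite eq_complex /= => /andP[/eqP c /eqP s].
by rewrite -(cos2Dsin2 x) c s expr0n addr0 eqxx.
Qed.

Lemma expiX x n : expi x ^+ n = expi (x *+ n).
Proof.
elim: n => [|n IH]; last by rewrite exprS mulrS IH expiD.
by rewrite expr0 mulr0n /expi sin0 cos0.
Qed.

Lemma expiB x y :
  expi (x *+ 2) - expi (y *+ 2) = expi (x + y) * (0 +i* (sin (x - y) *+ 2)).
Proof.
have -> : x *+ 2 = (x + y) + (x - y) by ring.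
have -> : y *+ 2 = (x + y) + - (x - y) by ring.
rewrite (expiD _ (x - y)) (expiD _ (- (x - y))) -mulrBr; congr (_ * _).
by apply/eqP; rewrite /expi eq_complex /= cosN sinN subrr opprK mulr2n !eqxx.
Qed.

(** Interpolation at x_b = e^(2i th_b) with t = e^(2ih): each of the k - 1 factors is e^(ih) times a
    quotient of sines, and t - 1 = e^(ih) 2i sin h. The phase e^(ihk) then cancels on both sides,
    and imaginary parts are compared. *)
Lemma sum_prod_sin_div k h (th : 'I_k -> R) :
  (forall b c, c != b -> sin (th b - th c) != 0) ->
  sin h * (\sum_b \prod_(c | c != b) (sin (th b - th c + h) / sin (th b - th c)))
  = sin (h *+ k).
Proof.
move=> sin_neq0.
have i2_neq0 (s : R) : s != 0 -> (0 +i* (s *+ 2) : R[i]) != 0.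
  by rewrite eq_complex /= eqxx mulrn_eq0.
pose x b := expi (th b *+ 2).
have x_inj : injective x.
  move=> b c e; apply/eqP; apply: contraT => ne.
  move: e; rewrite /x => e; have := expiB (th b) (th c); rewrite e subrr => /esym/eqP.
  rewrite mulf_eq0 (negbTE (expi_neq0 _)) /= (negbTE (i2_neq0 _ _)) //.
  by apply: sin_neq0; rewrite eq_sym.
have := sum_interpolation _ _ (expi (h *+ 2)) _ x_inj (fun b => expi_neq0 _).
have expi0 : expi 0 = 1 by rewrite /expi sin0 cos0.
have -> : expi (h *+ 2) - 1 = expi h * (0 +i* (sin h *+ 2)).
  by have := expiB h 0; rewrite mul0rn addr0 subr0 expi0.
have -> : expi (h *+ 2) ^+ k - 1 = expi (h *+ k) * (0 +i* (sin (h *+ k) *+ 2)).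
  have := expiB (h *+ k) 0; rewrite mul0rn addr0 subr0 expi0 => <-.
  by rewrite expiX -!mulrnA mulnC.
have -> : \sum_b \prod_(c | c != b) ((expi (h *+ 2) * x b - x c) / (x b - x c))
  = \sum_b expi (h *+ k.-1) * (\prod_(c | c != b)
       (sin (th b - th c + h) / sin (th b - th c)))%:C.
  apply: eq_bigr => b _; rewrite rmorph_prod /=.
  have -> : expi (h *+ k.-1) = \prod_(c | c != b) expi h.
    by rewrite prodr_const cardC1 card_ord expiX.
  rewrite -big_split /=; apply: eq_bigr => c ne.
  rewrite /x -expiD -mulrnDl !expiB.
  have -> : expi (h + th b + th c) = expi h * expi (th b + th c).
    by rewrite -expiD addrA.
  have -> : h + th b - th c = th b - th c + h by ring.
  apply: (mulIf (mulf_neq0 (expi_neq0 (th b + th c)) (i2_neq0 _ (sin_neq0 _ _ ne)))).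
  rewrite divfK ?mulf_neq0 ?expi_neq0 ?i2_neq0 ?sin_neq0 //.
  have -> : 0 +i* (sin (th b - th c + h) *+ 2) =
    (sin (th b - th c + h) / sin (th b - th c))%:C *
    (0 +i* (sin (th b - th c) *+ 2)) :> R[i].
    apply/eqP; rewrite eq_complex /= !mul0r mulr0 subrr addr0 eqxx /= mulrnAr.
    by rewrite divfK ?eqxx // sin_neq0.
  by ring.
rewrite -mulr_sumr -rmorph_sum /=.
(* For k = 0 the truncated [k.-1] breaks the phase count, but both sides vanish. *)
case: k th sin_neq0 {x x_inj} => [|k] th sin_neq0.
  by move=> _; rewrite big_ord0 mulr0 mulr0n sin0.
rewrite [h *+ k.+1]mulrS expiD /= => e.
have := mulfI (mulf_neq0 (expi_neq0 h) (expi_neq0 (h *+ k))).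
set S := \sum_(b < _) _ in e *; move=> inj.
have {}e : (0 +i* (sin h *+ 2)) * S%:C = 0 +i* (sin (h + h *+ k) *+ 2) :> R[i].
  by apply: inj; rewrite -e; ring.
move/eqP: e; rewrite eq_complex /= => /andP[_ /eqP].
by rewrite mulr0 add0r mulrnAl => /(@pmulrnI _ 2 isT).
Qed.
End SineIdentity.

(** * Taylor bounds and the comparison with the dimension *)

Section SineBounds.
Variable R : realType.

(** Each Taylor bound below integrates the previous one, starting from cos <= 1. *)
Lemma le_of_derive_le (f g f' g' : R -> R) :
  (forall x, is_derive x (1 : R) f (f' x)) ->
  (forall x, is_derive x (1 : R) g (g' x)) ->
  f 0 = g 0 -> (forall x, 0 <= x -> f' x <= g' x) ->
  forall x, 0 <= x -> f x <= g x.
Proof.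
move=> df dg e0 le' x x_ge0; rewrite -subr_ge0.
have dgf y : is_derive y (1 : R) (fun x => g x - f x) (g' y - f' y).
  exact: is_deriveB.
have -> : 0 = (fun x => g x - f x) 0 :> R by rewrite /= e0 subrr.
apply: (@ger0_derive1_le_cc _ (fun x => g x - f x) 0 x) => //=.
- by move=> y; rewrite in_itv /= derive1E => /andP[/ltW y_ge0 _];
    rewrite derive_val subr_ge0 le'.
- apply: continuous_subspaceT => y; apply: differentiable_continuous.
  exact/derivable1_diffP.
- by rewrite in_itv /= lexx.
- by rewrite in_itv /= x_ge0 lexx.
Qed.

Lemma sin_le x : 0 <= x -> sin x <= x :> R.
Proof.
apply: (@le_of_derive_le sin id cos (fun=> 1)) => [|y _]; rewrite ?sin0 //.
exact: cos_le1.
Qed.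

Lemma cos_ge_taylor2 x : 0 <= x -> 1 - x ^+ 2 / 2 <= cos x :> R.
Proof.
apply: (@le_of_derive_le (fun x => 1 - x ^+ 2 / 2) cos
  (fun x => - x) (fun x => - sin x)).
- move=> y; apply: is_derive_eq; rewrite /GRing.scale /=; lra.
- by rewrite cos0 expr0n mul0r subr0.
- by move=> y /sin_le; rewrite lerN2.
Qed.

Lemma sin_ge_taylor3 x : 0 <= x -> x - x ^+ 3 / 6 <= sin x :> R.
Proof.
apply: (@le_of_derive_le (fun x => x - x ^+ 3 / 6) sin (fun x => 1 - x ^+ 2 / 2) cos).
- move=> y; apply: is_derive_eq; rewrite /GRing.scale /=; lra.
- by rewrite sin0 expr0n mul0r subr0.
- exact: cos_ge_taylor2.
Qed.

Lemma cos_le_taylor4 x : 0 <= x -> cos x <= 1 - x ^+ 2 / 2 + x ^+ 4 / 24 :> R.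
Proof.
apply: (@le_of_derive_le cos (fun x => 1 - x ^+ 2 / 2 + x ^+ 4 / 24) (fun x => - sin x)
  (fun x => - (x - x ^+ 3 / 6))).
- move=> y; apply: is_derive_eq; rewrite /GRing.scale /=; lra.
- by rewrite cos0 !expr0n !mul0r subr0 addr0.
- by move=> y /sin_ge_taylor3; rewrite lerN2.
Qed.

(** With z = (pi/2)^2, the quartic bound at cos (pi/2) = 0 reads z^2 - 12 z + 24 >= 0, which fails
    for 3 <= z < 4; since z < 4, it follows that z < 3. *)
Lemma pi_sqr_lt12 : pi ^+ 2 < 12 :> R.
Proof.
have /andP[h0 h2] := @pihalf_02 R.
have := cos_le_taylor4 (pi / 2) (ltW h0); rewrite cos_pihalf.
have -> : pi ^+ 2 = 4 * (pi / 2) ^+ 2 :> R by field.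
move: (pi / 2) h0 h2 => y h0 h2; rewrite (exprM y 2 2).
have : y ^+ 2 < 4 by nra.
by move: (y ^+ 2) => z z4 le; nra.
Qed.

(** The recurrence for sin((k+2)x) has step two, so the induction carries two consecutive cases.
    With c(k) = k(k^2-1)/6 one has c(k+2) - c(k) = (k+1)^2, exactly the loss in 2 cos((k+1)x) >= 2 -
    (k+1)^2 x^2. *)
Lemma sin_muln_ge_taylor (x : R) k : 0 < x -> x < pi ->
  sin x * (k%:R - x ^+ 2 * k%:R * (k%:R ^+ 2 - 1) / 6) <= sin (x *+ k).
Proof.
move=> x0 xpi; have sx : 0 < sin x by apply: sin_gt0_pi; rewrite x0.
have [] : sin x * (k%:R - x ^+ 2 * k%:R * (k%:R ^+ 2 - 1) / 6) <= sin (x *+ k)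
  /\ sin x * (k.+1%:R - x ^+ 2 * k.+1%:R * (k.+1%:R ^+ 2 - 1) / 6) <= sin (x *+ k.+1);
  last by [].
elim: k => [|k [IH0 IH1]]; first by rewrite mulr0n mulr1n sin0; split; lra.
split=> //.
have -> : sin (x *+ k.+2) = sin (x *+ k) + 2 * (sin x * cos (x *+ k.+1)).
  have -> : x *+ k.+2 = x *+ k.+1 + x by rewrite [LHS]mulrS addrC.
  have -> : x *+ k = x *+ k.+1 - x by rewrite mulrS addrAC subrr add0r.
  by rewrite sinD sinB; ring.
have := ler_wpM2l (ltW sx) (cos_ge_taylor2 (x *+ k.+1) (mulrn_wge0 _ (ltW x0))).
rewrite -mulr_natr -![k.+2%:R]natr1 -![k.+1%:R]natr1 => IH2.
nra.
Qed.

Lemma sin_ratio_gt_dim k n : (0 < k)%N -> (k * 2 <= n)%N -> (1 < n)%N ->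
  let d := n%:R * sin (pi / n%:R *+ k) / sin (pi / n%:R) : R in
  if k == 1%N then d = (k * (n - k) + 1)%N%:R else (k * (n - k) + 1)%N%:R < d.
Proof.
move=> k0 kn n1 d; rewrite {}/d.
have n0 : 0 < n%:R :> R by rewrite ltr0n; lia.
have h0 : 0 < pi / n%:R :> R by rewrite divr_gt0 ?pi_gt0.
have hpi : pi / n%:R < pi :> R.
  by rewrite ltr_pdivrMr // ltr_pMr ?pi_gt0 // ltr1n.
have sh : 0 < sin (pi / n%:R) :> R by apply: sin_gt0_pi; rewrite h0.
case: eqP => [->|/eqP k1].
  by rewrite mulfK ?gt_eqF // mul1n subnK // ltnW.
rewrite natrD natrM natrB; last by lia.
rewrite ltr_pdivlMr //.
have := sin_muln_ge_taylor _ k h0 hpi.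
rewrite expr_div_n -(ler_pM2l n0); apply: lt_le_trans.
rewrite mulrCA [ltLHS]mulrC ltr_pM2l //.
have pi2 := pi_sqr_lt12; set p := pi ^+ 2 in pi2 *.
have -> : n%:R * (k%:R - p / n%:R ^+ 2 * k%:R * (k%:R ^+ 2 - 1) / 6)
  = n%:R * k%:R - p * (k%:R / n%:R) * (k%:R ^+ 2 - 1) / 6 :> R.
  by field; rewrite gt_eqF.
(* The ratio q = k/n is at most 1/2, so pi^2 q < 6. *)
have q2 : k%:R / n%:R * 2 <= 1 :> R.
  by rewrite mulrAC ler_pdivrMr // mul1r -natrM ler_nat.
have q0 : 0 < k%:R / n%:R :> R by rewrite divr_gt0 // ltr0n.
have kk : 2 <= k%:R :> R by rewrite ler_nat; lia.
set q := k%:R / n%:R in q2 q0 *.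
have pq : p * q < 6 by nra.
have kk1 : 0 < k%:R ^+ 2 - 1 :> R by nra.
have := mulr_gt0 (_ : 0 < 6 - p * q) kk1; rewrite subr_gt0 => /(_ pq).
lra.
Qed.
End SineBounds.

(** * A Perron-Frobenius criterion *)

(* Pairing |v| with u turns |e| |v_j| <= sum_i |v_i| A_ij into |e| <= d. *)
Lemma largest_eigenvalue_pos_col (R : realType) (N : nat)
    (A : 'M[R]_N) (u : 'cV[R]_N) d :
  (0 < N)%N -> (forall i j, 0 <= A i j) -> (forall i, 0 < u i 0) ->
  A *m u = d *: u ->
  largest_real_eigenvalue A d.
Proof.
move=> N0 A0 u0 Au; split.
  (* [eigenvalue] refers to row vectors while [u] is a column, so the eigenvalue is carried over
     from the transpose, which has the same characteristic polynomial. *)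
  rewrite eigenvalue_root_char; have -> : char_poly A = char_poly A^T.
    rewrite /char_poly /char_poly_mx -det_tr linearB /= tr_scalar_mx.
    by rewrite map_trmx.
  rewrite -eigenvalue_root_char; apply/eigenvalueP; exists u^T.
    by rewrite -trmx_mul Au linearZ.
  apply/negP => /eqP/(congr1 (fun v : 'rV_N => v 0 (Ordinal N0))).
  by rewrite !mxE => u00; have := u0 (Ordinal N0); rewrite u00 ltxx.
move=> e /eigenvalueP[v vA v_neq0].
pose s := \sum_i `|v 0 i| * u i 0.
have s_gt0 : 0 < s.
  have [i vi] : exists i, v 0 i != 0.
    apply/existsP; apply: contraNT v_neq0 => /existsPn v0.
    by apply/eqP/rowP => i; rewrite mxE; apply/eqP; have := v0 i; rewrite negbK.
  rewrite /s (bigD1 i) //= ltr_pwDl ?mulr_gt0 ?normr_gt0 //.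
  by apply: sumr_ge0 => j _; rewrite mulr_ge0 // ltW.
rewrite -(ler_pM2r s_gt0) mulr_sumr.
have -> : d * s = \sum_j \sum_i `|v 0 i| * A i j * u j 0.
  rewrite exchange_big mulr_sumr; apply: eq_bigr => i _ /=.
  have := congr1 (fun w : 'cV_N => w i 0) Au; rewrite !mxE => e1.
  by rewrite mulrCA -e1 mulr_sumr; apply: eq_bigr => j _; rewrite mulrA.
apply: ler_sum => j _; rewrite -mulr_suml mulrA ler_pM2r //.
apply: le_trans (_ : `|e * v 0 j| <= _).
  by rewrite normrM ler_wpM2r // ler_norm.
have := congr1 (fun w : 'rV_N => w 0 j) vA; rewrite !mxE => <-.
apply: le_trans (ler_norm_sum _ _ _) _; apply: ler_sum => i _.
by rewrite normrM (ger0_norm (A0 i j)).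
Qed.

(** * Vandermonde products of sines *)

Section SineVandermonde.
Variable R : realType.

(** The filler 1 makes the product range over a full square, so that rows and columns can be split
    off and exchanged. *)
Definition sin_vdm k (th : 'I_k -> R) : R :=
  \prod_(i < k) \prod_(j < k) (if (i < j)%N then sin (th i - th j) else 1).

Lemma eq_sin_vdm k (th th' : 'I_k -> R) : th =1 th' -> sin_vdm k th = sin_vdm k th'.
Proof.
by move=> e; apply: eq_bigr => i _; apply: eq_bigr => j _; rewrite !e.
Qed.

(** Only pairs containing b change. When b is the second index, numerator and denominator both
    change sign, so the quotient has the same form. *)
Lemma sin_vdm_shift k (th : 'I_k -> R) h b :
  (forall b c, c != b -> sin (th b - th c) != 0) ->
  sin_vdm k (fun i => th i + h *+ (i == b)) = sin_vdm k th *
    \prod_(c | c != b) (sin (th b - th c + h) / sin (th b - th c)).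
Proof.
move=> sin_neq0; pose r c := sin (th b - th c + h) / sin (th b - th c).
have -> : \prod_(c | c != b) r c =
    \prod_(i < k) \prod_(j < k) ((if (i == b) && (i < j)%N then r j else 1) *
                     (if (j == b) && (i < j)%N then r i else 1)).
  move: r => r; under [RHS]eq_bigr => i _ do rewrite big_split /=.
  rewrite big_split /= [X in _ * X]exchange_big /=.
  have sel (F : 'I_k -> 'I_k -> R) :
      (forall i j, i != b -> F i j = 1) -> \prod_i \prod_j F i j = \prod_j F b j.
    move=> F1; rewrite (bigD1 b) //= [X in _ * X]big1 ?mulr1 // => i ne.
    by apply: big1 => j _; rewrite F1.
  rewrite !sel => [|i j /negbTE->|i j /negbTE->] //.
  rewrite -big_split /= big_mkcond /=; apply: eq_bigr => c _; rewrite eqxx /=.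
  by rewrite -val_eqE /=; case: ltngtP => _; rewrite ?mulr1 ?mul1r.
rewrite /sin_vdm -big_split /=; apply: eq_bigr => i _.
rewrite -big_split /=; apply: eq_bigr => j _.
case: ltnP => [ij|]; last by rewrite !andbF !mulr1.
have [ib|ib] := eqVneq i b; have [jb|jb] := eqVneq j b.
- by move: ij; rewrite ib jb ltnn.
- rewrite ib /= mulr1n mulr0n addr0 mulr1 /r mulrC divfK; last exact: sin_neq0.
  by congr (sin _); ring.
- rewrite /= mulr1n mulr0n addr0 mul1r /r jb.
  rewrite -(opprB (th b) (th i)) sinN mulrC mulrN divfK; last exact: sin_neq0.
  by rewrite -sinN; congr (sin _); ring.
by rewrite /= !mulr0n !addr0 !mulr1.
Qed.

Lemma sum_sin_vdm_shift k h (th : 'I_k -> R) :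
  (forall b c, c != b -> sin (th b - th c) != 0) ->
  sin h * (\sum_b sin_vdm k (fun i => th i + h *+ (i == b))) =
  sin (h *+ k) * sin_vdm k th.
Proof.
move=> sin_neq0; rewrite -(sum_prod_sin_div _ k h th sin_neq0).
under eq_bigr => b _ do rewrite sin_vdm_shift //.
by rewrite -mulr_sumr mulrCA mulrC.
Qed.

Lemma sin_vdm_eq0 k (th : 'I_k -> R) (i j : 'I_k) :
  (i < j)%N -> sin (th i - th j) = 0 -> sin_vdm k th = 0.
Proof.
move=> ij s0; rewrite /sin_vdm (bigD1 i) //= (bigD1 j) //= ij s0.
by rewrite !mul0r.
Qed.

(* The jump n-1 -> 0: relabelling the first particle as the last one lowers its
   angle by pi, and the sign of sin (x + pi) is absorbed by the swapped order. *)
Lemma sin_vdm_rotate k (th th' : 'I_k.+1 -> R) :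
  (forall i : 'I_k, th' (widen_ord (leqnSn k) i) = th (lift ord0 i)) ->
  th ord0 = th' ord_max + pi -> sin_vdm k.+1 th = sin_vdm k.+1 th'.
Proof.
move=> e1 e2; rewrite /sin_vdm big_ord_recl [RHS]big_ord_recr /=.
rewrite big_ord_recl /= mul1r [X in _ = _ * X]big1 ?mulr1; last first.
  by move=> j _; rewrite ltnNge -ltnS ltn_ord.
under [RHS]eq_bigr => i _ do rewrite big_ord_recr /= ltn_ord.
rewrite [RHS]big_split /= mulrC; congr (_ * _).
  apply: eq_bigr => i _; rewrite big_ord_recl /= mul1r.
  by apply: eq_bigr => j _; rewrite !e1 ltnS.
apply: eq_bigr => i _; rewrite e1 e2.
by rewrite addrAC sinDpi -sinN opprB.
Qed.
End SineVandermonde.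

(** * Partitions and adding one box *)

Section Partitions.
Variables (k n : nat).
Implicit Types l mu : Lambda k n.

Definition part l (i : 'I_k) : nat := val (val l i).

Lemma part_le l i : (part l i <= n - k)%N.
Proof. by rewrite -ltnS ltn_ord. Qed.

Lemma part_nonincr l (i j : 'I_k) : (i <= j)%N -> (part l j <= part l i)%N.
Proof.
by move=> ij; have /forallP/(_ i)/forallP/(_ j)/implyP := valP l; apply.
Qed.

Lemma part_inj l mu : part l =1 part mu -> l = mu.
Proof. by move=> e; apply/val_inj/ffunP => i; apply/val_inj/e. Qed.

Lemma part_exists (f : 'I_k -> nat) :
  (forall i, f i <= n - k)%N -> (forall i j : 'I_k, i <= j -> f j <= f i)%N ->
  exists l, part l =1 f.
Proof.
move=> f_le f_mono; pose g : {ffun 'I_k -> 'I_(n - k).+1} := [ffun i => inord (f i)].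
have gE i : val (g i) = f i by rewrite ffunE /= inordK // ltnS f_le.
have g_ok : nonincr g.
  by apply/forallP => i; apply/forallP => j; apply/implyP => ij; rewrite !gE f_mono.
by exists (Sub g g_ok) => i; rewrite /part /= gE.
Qed.

Lemma nth_parts l (i : 'I_k) : nth 0%N (parts l) i = part l i.
Proof. by rewrite (nth_map i) ?size_enum_ord // nth_ord_enum. Qed.

Lemma psizeE l : (psize l = \sum_i part l i)%N.
Proof. by rewrite /psize /parts sumnE big_map big_enum. Qed.

Definition adds_box l mu (b : 'I_k) := [forall i, part mu i == part l i + (i == b)]%N.

(** Containment with size difference 1 concentrates the excess in a single row, and that row is
    unique. The sum form indexes successors by the particle that moves. *)
Lemma is_succE l mu : (is_succ l mu = \sum_b adds_box l mu b :> nat)%N.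
Proof.
have [/existsP[b b_ok]|no] := boolP [exists b, adds_box l mu b].
  have muE i : part mu i = (part l i + (i == b))%N by apply/eqP/(forallP b_ok).
  rewrite (bigD1 b) //= b_ok big1 => [|c cb].
    rewrite addn0 /is_succ !psizeE; apply/eqP; rewrite eqb1; apply/andP; split.
      under eq_bigr => i _ do rewrite muE.
      rewrite big_split /= [X in (_ + X)%N](bigD1 b) //= eqxx.
      by rewrite [X in (true + X)%N]big1 ?addn1 // => i /negbTE->.
    by apply/forallP => i; rewrite [X in (_ <= X)%N]muE leq_addr.
  apply/eqP; rewrite eqb0; apply/forallPn; exists b.
  by rewrite muE eqxx (eq_sym b c) (negbTE cb) addn0 addn1 gtn_eqF.
rewrite big1 => [|b _]; last by apply/eqP; rewrite eqb0; exact: (existsPn no).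
apply/eqP; rewrite eqb0; apply: contra no => /andP[/eqP sz /forallP sub].
have {}sub i : (part l i <= part mu i)%N by exact: sub.
have : (\sum_i (part mu i - part l i) == 1)%N.
  by rewrite sumnB // -!psizeE sz subSnn.
case/sum_nat_eq1 => b [_ b1 other]; apply/existsP; exists b; apply/forallP => i.
have := sub i; case: (eqVneq i b) => [->|ib] le /=; first by lia.
by have := other i ib isT; lia.
Qed.

End Partitions.

(** * The ground state as a positive eigenvector *)

Definition angle (R : realType) (n : nat) : R := pi / n%:R.

Lemma angle_muln (R : realType) n : (0 < n)%N -> angle R n *+ n = pi.
Proof. by move=> n0; rewrite -mulr_natr divfK // pnatr_eq0 -lt0n. Qed.

Section GroundState.
Variables (R : realType) (k n : nat).
Hypothesis (hkn : (k.+1 <= n - 1)%N).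
Implicit Types l mu : Lambda k.+1 n.
Local Notation part := (part k.+1 n).
Local Notation adds_box := (adds_box k.+1 n).

Local Notation h := (angle R n).
Let n_gt0 : (0 < n)%N. Proof. lia. Qed.
Let angle_n : h *+ n = pi. Proof. exact: angle_muln. Qed.

(** There are [k.+1] rows numbered from 0, so [k - i] is the offset that puts the positions,
    strictly decreasing, in {0, ..., n-1}. *)
Definition particle l (i : 'I_k.+1) : R := h *+ (part l i + (k - i)).

Definition ground_state l : R := sin_vdm R k.+1 (particle l).

Lemma sin_angle_gt0 m : (0 < m < n)%N -> 0 < sin (h *+ m).
Proof.
move=> /andP[m0 mn]; have h0 : 0 < h by rewrite divr_gt0 ?pi_gt0 // ltr0n; lia.
apply: sin_gt0_pi; rewrite pmulrn_lgt0 // h0 -angle_n /=.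
by rewrite ltr_pMn2l.
Qed.

Lemma sin_particle_gt0 l (i j : 'I_k.+1) : (i < j)%N ->
  0 < sin (particle l i - particle l j).
Proof.
move=> ij; rewrite /particle -mulrnBr; last first.
  by have := part_nonincr _ _ l i j (ltnW ij); have := ltn_ord j; lia.
apply: sin_angle_gt0; have := part_nonincr _ _ l i j (ltnW ij).
by have := part_le _ _ l i; have := ltn_ord j; lia.
Qed.

Lemma ground_state_gt0 l : 0 < ground_state l.
Proof.
apply: prodr_gt0 => i _; apply: prodr_gt0 => j _.
by case: ifP => // ij; apply: sin_particle_gt0.
Qed.

Lemma sin_particle_neq0 l b c : c != b -> sin (particle l b - particle l c) != 0.
Proof.
rewrite -val_eqE /=; case: ltngtP => // cb _; last first.
  by rewrite gt_eqF // sin_particle_gt0.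
by rewrite -opprB sinN oppr_eq0 gt_eqF // sin_particle_gt0.
Qed.

(** The move of particle b is taken formally, whether or not the new configuration is admissible. *)
Local Notation hop l b := (sin_vdm R k.+1 (fun i => particle l i + h *+ (i == b))).

Lemma sum_single (P : pred (Lambda k.+1 n)) (F : Lambda k.+1 n -> R) m :
  P m -> (forall mu, P mu -> mu = m) -> \sum_mu (P mu)%:R * F mu = F m.
Proof.
move=> Pm uniq; rewrite (bigD1 m) //= Pm mul1r big1 ?addr0 // => mu.
by case: (boolP (P mu)) => [/uniq->|_]; rewrite ?eqxx // mul0r.
Qed.

Lemma sum_none (P : pred (Lambda k.+1 n)) (F : Lambda k.+1 n -> R) :
  (forall mu, ~~ P mu) -> \sum_mu (P mu)%:R * F mu = 0.
Proof. by move=> no; apply: big1 => mu _; rewrite (negbTE (no mu)) mul0r. Qed.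

Lemma sum_adds_box l b :
  (part l b < n - k.+1)%N -> (forall i : 'I_k.+1, i < b -> part l b < part l i)%N ->
  \sum_mu (adds_box l mu b)%:R * ground_state mu = hop l b.
Proof.
move=> lt_top lt_prev.
have [mu muE] : exists mu, part mu =1 (fun i => part l i + (i == b))%N.
  apply: part_exists => [i|i j ij].
    by case: eqP => [->|_]; have := part_le _ _ l i; lia.
  have := part_nonincr _ _ l i j ij.
  case: (eqVneq i b) => [->|ib]; first by case: eqP; lia.
  case: (eqVneq j b) => [jb|_]; last by lia.
  have : (i < b)%N by rewrite ltn_neqAle val_eqE ib -jb.
  by move/lt_prev; rewrite jb; lia.
rewrite (sum_single _ _ mu).
- apply: eq_sin_vdm => i; rewrite /particle muE -mulrnDr; congr (_ *+ _); lia.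
- by apply/forallP => i; rewrite muE.
by move=> mu' /forallP mu'E; apply: part_inj => i; rewrite muE; apply/eqP.
Qed.

Lemma sum_adds_box0 l b :
  (part l b = n - k.+1)%N \/ (exists2 i : 'I_k.+1, i < b & part l b = part l i)%N ->
  \sum_mu (adds_box l mu b)%:R * ground_state mu = 0.
Proof.
move=> blocked; apply: sum_none => mu; apply/negP => /forallP muE.
have mub : part mu b = (part l b).+1 by have /eqP-> := muE b; rewrite eqxx addn1.
case: blocked => [top|[i ib e]].
  by have := part_le _ _ mu b; rewrite mub top ltnn.
have := part_nonincr _ _ mu i b (ltnW ib); rewrite mub e.
by have /eqP-> := muE i; rewrite -val_eqE /= ltn_eqF // addn0 ltnn.
Qed.

(** Particle b lands on its neighbour i, giving a factor sin 0; hence forbidden moves may stay in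
    the sum over all b. *)
Lemma hop_blocked l (b i : 'I_k.+1) :
  i.+1 = b :> nat -> part l b = part l i -> hop l b = 0.
Proof.
move=> ib e; apply: (@sin_vdm_eq0 _ _ _ i b); first by rewrite -ib.
rewrite eqxx -val_eqE /= ltn_eqF -?ib // mulr0n addr0 /particle e -ib.
rewrite -mulrnDr -addnA addn1 subnSK ?subrr ?sin0 //.
by have := ltn_ord b; rewrite -ib.
Qed.

Lemma is_starE l mu : is_star l mu =
  [&& part l ord0 == n - k.+1, 0 < part l ord_max &
      [forall i : 'I_k.+1, part mu i ==
        (if i.+1 < k.+1 then (nth 0 (parts l) i.+1).-1 else 0)]]%N.
Proof.
rewrite /is_star /= (nth_parts _ _ l ord0) (nth_parts _ _ l ord_max).
by congr [&& _, _ & _]; apply: eq_forallb => i; rewrite nth_parts.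
Qed.

(** The first particle sits at n-1 and hops to n. If the last one sits at 0, the two angles differ
    by pi: the hop vanishes, and no lambda^* exists. Otherwise the rotated configuration is that of
    lambda^*. *)
Lemma sum_star l : part l ord0 = (n - k.+1)%N ->
  \sum_mu (is_star l mu)%:R * ground_state mu = hop l ord0.
Proof.
move=> top; have [last0|last_gt0] := posnP (part l ord_max).
  rewrite sum_none => [|mu]; last by rewrite is_starE last0 ltnn andbF.
  have k0 : (0 < k)%N.
    rewrite lt0n; apply/eqP => k0; move: top.
    rewrite (_ : ord0 = ord_max) ?last0; [lia | exact/val_inj].
  symmetry; apply: (@sin_vdm_eq0 _ _ _ ord0 ord_max) => //.
  rewrite eqxx -val_eqE /= gtn_eqF // mulr0n addr0 /particle top last0.
  by rewrite -mulrnDr subnn mulr0n subr0 (_ : (_ + 1)%N = n) ?angle_n ?sinpi //=; lia.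
pose f (i : 'I_k.+1) := (if i.+1 < k.+1 then (nth 0 (parts l) i.+1).-1 else 0)%N.
have fE (i j : 'I_k.+1) : i.+1 = j -> f i = (part l j).-1.
  by move=> ij; rewrite /f ij ltn_ord nth_parts.
have f0 : f ord_max = 0%N by rewrite /f ltnn.
have f_spec i : f i = 0%N \/ exists2 j : 'I_k.+1, i.+1 = j & f i = (part l j).-1.
  rewrite /f; case: ltnP => [ik|]; [right|by left].
  by exists (Ordinal ik) => //; rewrite -nth_parts.
have [mu muE] : exists mu, part mu =1 f.
  apply: part_exists => [i|i j ij].
    by case: (f_spec i) => [->//|[j _ ->]]; have := part_le _ _ l j; lia.
  case: (f_spec j) => [->//|[j' jj' ->]].
  have i_lt : (i.+1 < k.+1)%N by have := ltn_ord j'; rewrite -jj'; lia.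
  rewrite (fE i (Ordinal i_lt)) //.
  have := part_nonincr _ _ l (Ordinal i_lt) j'; rewrite -jj' /= ltnS => /(_ ij).
  by lia.
rewrite (sum_single _ _ mu).
- apply/esym/sin_vdm_rotate => [i|].
    (* Lowering the index by one raises the offset by one, which offsets the decrement of the part;
       that part is positive because the last one is. *)
    rewrite mulr0n addr0 /particle muE (fE _ (lift ord0 i)) //; congr (_ *+ _).
    have := part_nonincr _ _ l (lift ord0 i) ord_max; rewrite -ltnS ltn_ord => /(_ isT).
    by rewrite /= /bump /=; have := ltn_ord i; lia.
  rewrite eqxx /particle muE f0 top subnn mulr0n add0r -mulrnDr.
  by rewrite (_ : (_ + true)%N = n) ?angle_n //=; lia.
- by rewrite is_starE top eqxx last_gt0; apply/forallP => i; rewrite muE.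
move=> mu'; rewrite is_starE => /and3P[_ _ /forallP mu'E].
by apply: part_inj => i; rewrite muE; apply/eqP.
Qed.

Lemma sum_star0 l : part l ord0 <> (n - k.+1)%N ->
  \sum_mu (is_star l mu)%:R * ground_state mu = 0.
Proof. by move/eqP => top; apply: sum_none => mu; rewrite is_starE (negbTE top). Qed.

(** Terms match particle by particle: the first contributes through lambda^* if it is at n-1 and
    through a box otherwise; each later one either gains a box or is blocked by its predecessor,
    both sides then being 0. *)
Lemma sum_neighbours l :
  \sum_mu ((is_star l mu)%:R + (is_succ l mu)%:R) * ground_state mu =
  \sum_b hop l b.
Proof.
have succE mu : (is_succ l mu)%:R = \sum_b (adds_box l mu b)%:R :> R.
  by rewrite is_succE natr_sum.
under eq_bigr => mu _ do rewrite mulrDl succE mulr_suml.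
rewrite big_split /= exchange_big /= [RHS]big_ord_recl [X in _ + X]big_ord_recl.
rewrite addrA; congr (_ + _).
  have [top|ntop] := eqVneq (part l ord0) (n - k.+1)%N.
    by rewrite sum_star // sum_adds_box0 ?addr0 //; left.
  rewrite sum_star0 ?add0r; last exact/eqP.
  by rewrite sum_adds_box // ltn_neqAle ntop part_le.
apply: eq_bigr => /= b _; set c := lift (ord0 : 'I_k.+1) (b : 'I_k).
pose p : 'I_k.+1 := widen_ord (leqnSn k) b.
have pc : p.+1 = c by [].
have := part_nonincr _ _ l p c; rewrite -pc leqnSn => /(_ isT).
rewrite leq_eqVlt => /predU1P[e|lt].
  rewrite (hop_blocked _ _ p) // sum_adds_box0 //.
  by right; exists p; rewrite // -pc.
apply: sum_adds_box; first by apply: leq_trans lt _; exact: part_le.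
move=> i; rewrite -pc ltnS => ip; apply: leq_trans lt _; exact: part_nonincr.
Qed.

Lemma largest_eigenvalue_c1hat :
  largest_real_eigenvalue (c1hat R k.+1 n) (n%:R * sin (h *+ k.+1) / sin h).
Proof.
have sh : 0 < sin h by have := sin_angle_gt0 1; rewrite mulr1n; apply; lia.
apply: (@largest_eigenvalue_pos_col _ _ _ (\col_i ground_state (enum_val i))).
(* The zero partition shows that the basis is nonempty. *)
- have [l _] := part_exists k.+1 n (fun=> 0%N) (fun=> leq0n _) (fun _ _ _ => leqnn _).
  by apply/card_gt0P; exists l.
- by move=> i j; rewrite mxE mulr_ge0 ?addr_ge0 ?ler0n.
- by move=> i; rewrite mxE ground_state_gt0.
apply/colP => i; rewrite !mxE; set l := enum_val i.
under eq_bigr => j _ do rewrite !mxE -mulrA.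
rewrite -mulr_sumr -(big_enum_val (fun mu =>
  ((is_star l mu)%:R + (is_succ l mu)%:R) * ground_state mu)) (eq_bigl xpredT) //=.
rewrite sum_neighbours -!mulrA; congr (_ * _).
apply: (mulfI (lt0r_neq0 sh)); rewrite sum_sin_vdm_shift.
  by rewrite [RHS]mulrCA mulVKf ?lt0r_neq0 // mxE.
exact: sin_particle_neq0.
Qed.
End GroundState.

(** * Reduction to 2k <= n and conclusion *)

Theorem theorem1p3 (R : realType) (k n : nat) (hk1 : (1 <= k)%N) (hkn : (k <= n - 1)%N) :
  exists d : R, largest_real_eigenvalue (c1hat R k n) d /\
    ((k * (n - k) + 1)%N%:R <= d) /\
    (d = (k * (n - k) + 1)%N%:R <-> (k = 1%N \/ k = (n - 1)%N)).
Proof.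
exists (n%:R * sin (angle R n *+ k) / sin (angle R n)); split.
  by case: k hk1 hkn => // k' _ hkn'; exact: largest_eigenvalue_c1hat.
(* Here j = min(k, n-k): dimension and equality condition are symmetric, and sin(pi - x) = sin x
   keeps the eigenvalue. *)
have [j [j0 jn dim sinE jk]] : exists j, [/\ (0 < j)%N, (j * 2 <= n)%N,
    (j * (n - j) = k * (n - k))%N, sin (angle R n *+ j) = sin (angle R n *+ k) &
    j = 1%N <-> k = 1%N \/ k = (n - 1)%N].
  have [kn|kn] := leqP (k * 2) n; first by exists k; split=> //; lia.
  exists (n - k)%N; split; [lia | lia | | | lia].
    by rewrite mulnC subKn //; lia.
  rewrite mulrnBr; last by lia.
  by rewrite angle_muln ?(addrC pi) ?sinDpi ?sinN ?opprK //; lia.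
have n1 : (1 < n)%N by lia.
have := sin_ratio_gt_dim R j n j0 jn n1; rewrite dim sinE /=.
case: eqP => [j1 ->|j_neq1 lt].
  by rewrite lexx; split=> //; split=> // _; exact/jk.
split; first exact: ltW.
by split=> [e|/jk //]; move: lt; rewrite -/(angle R n) e ltxx.
Qed.
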